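(* If there exists a mixed Steiner system $\mathrm{MS}(2,k,\mathbb{Z}_2^n\times\mathbb{Z}_q)$, then $n\ge (k-2)(q-1)+1$, $k-1$ divides $n$, $q\equiv 2\pmod{k-1}$, and $k(k-1)$ divides $n(n+2q-3)$.
   Context: For integers $q_1,\dots,q_N\ge 2$, $Q=\mathbb{Z}_{q_1}\times\cdots\times\mathbb{Z}_{q_N}$ is viewed as the set of words of length $N$ whose $i$-th letter lies in $\mathbb{Z}_{q_i}$; $\mathbb{Z}_2^n\times\mathbb{Z}_q$ has $n\ge1$ binary coordinates and one coordinate over $\mathbb{Z}_q$, $q\ge 2$. The weight of a word is its number of nonzero coordinates, and $d(\cdot,\cdot)$ is the Hamming distance. For integers $1\le t\le k\le N$, a mixed Steiner system $\mathrm{MS}(t,k,Q)$ is a set $\mathcal{C}$ of words of $Q$ of weight $k$ such that (i) for every word $x\in Q$ of weight $t$ there is exactly one $c\in\mathcal{C}$ with $d(x,c)=k-t$; and (ii) any two distinct elements of $\mathcal{C}$ are at Hamming distance at least $2(k-t)+1$. *)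

(* Defs.v *)
From mathcomp Require Import all_boot all_order all_algebra.

Set Implicit Arguments.
Unset Strict Implicit.
Unset Printing Implicit Defensive.

Import GRing.Theory.

(* Words of Z_{q_1} x ... x Z_{q_N}. The type 'Z_m is the ring of integers
   modulo m only for m >= 2, so every q i has to be at least 2. *)
Definition word (N : nat) (q : 'I_N -> nat) : finType :=
  {dffun forall i : 'I_N, 'Z_(q i)}.

Definition weight (N : nat) (q : 'I_N -> nat) (x : word q) : nat :=
  #|[set i : 'I_N | x i != 0%R]|.

Definition hdist (N : nat) (q : 'I_N -> nat) (x y : word q) : nat :=
  #|[set i : 'I_N | x i != y i]|.

(* Meant for 1 <= t <= k <= N, where the subtraction k - t is exact. *)
Definition mixed_steiner (t k N : nat) (q : 'I_N -> nat) (C : {set word q}) :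
    Prop :=
  [/\ forall c : word q, c \in C -> weight c = k,
      forall x : word q, weight x = t ->
        exists! c : word q, c \in C /\ hdist x c = k - t
    & forall c c' : word q, c \in C -> c' \in C -> c != c' ->
        2 * (k - t) + 1 <= hdist c c'].

(* The alphabet sizes of Z_2^n x Z_q, whose last coordinate is over Z_q. *)
Definition binary_and (n q : nat) : 'I_n.+1 -> nat :=
  fun i => if i < n then 2 else q.

(* Main.v *)
Require Import Defs.
From mathcomp Require Import all_boot all_order all_algebra.
From mathcomp Require Import zify.

Set Implicit Arguments.
Unset Strict Implicit.
Unset Printing Implicit Defensive.

(** Weigh each coordinate [i] by its number [q i - 1] of nonzero letters. Two
    distinct coordinates carrying prescribed nonzero letters determine a unique
    codeword, so counting pairs (codeword, nonzero coordinate) shows that the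
    number r(i, a) of codewords with letter [a] at coordinate [i] satisfies
    (k-1) r(i, a) = \sum_(j != i) (q j - 1), and
    k (k-1) |C| = \sum_i (q i - 1) \sum_(j != i) (q j - 1).
    On Z_2^n x Z_q the former gives k-1 | n (last coordinate) and
    (k-1) r = n + q - 2 (binary coordinate), where r >= q - 1 because the q - 1
    nonzero last letters occur in distinct codewords; the latter reads
    k (k-1) |C| = n (n + 2q - 3). *)

Lemma card_nonzero_Zp (m : nat) : 1 < m -> #|[pred b : 'Z_m | b != 0%R]| = m - 1.
Proof.
by move=> m1; rewrite (cardC1 (0%R : 'Z_m)) card_ord (Zp_cast m1) subn1.
Qed.

Lemma sum_letters_card (N : nat) (q : 'I_N -> nat) (D : {set word q}) (j : 'I_N) :
  \sum_(b : 'Z_(q j) | b != 0%R) #|[set c in D | c j == b]|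
  = #|[set c in D | c j != 0%R]|.
Proof.
rewrite -sum1_card (partition_big (fun c : word q => c j) (fun b => b != 0%R)) /=;
  last by move=> c; rewrite inE => /andP[].
apply: eq_bigr => b b0; rewrite -sum1_card; apply: eq_bigl => c; rewrite !inE.
by case: eqP => [->|]; rewrite ?b0 ?andbT ?andbF.
Qed.

Lemma sum_coords_weight (N : nat) (q : 'I_N -> nat) (D : {set word q})
    (P : pred 'I_N) :
  \sum_(j | P j) #|[set c in D | c j != 0%R]|
  = \sum_(c in D) #|[set j | P j & c j != 0%R]|.
Proof.
under eq_bigr => j _ do rewrite -sum1dep_card big_mkcondr.
rewrite exchange_big /=; apply: eq_bigr => c _.
by rewrite -big_mkcondr sum1dep_card.
Qed.

Section PairwiseBalance.

Variables (N k : nat) (q : 'I_N -> nat) (C : {set word q}).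
Hypotheses (k_ge2 : 2 <= k) (q_ge2 : forall i, 1 < q i).
Hypothesis steinerC : mixed_steiner 2 k C.

(** The prescribed letters form a word [x] of weight 2; a codeword lies at distance [k - 2] from [x]
    exactly when it agrees with [x] at [i] and [j], so condition (i) applies. *)
Lemma card_codewords_with_two_letters (i j : 'I_N) (a : 'Z_(q i)) (b : 'Z_(q j)) :
  j != i -> a != 0%R -> b != 0%R ->
  #|[set c in [set c in C | c i == a] | c j == b]| = 1.
Proof.
move=> ji a0 b0; have [wC uniqC _] := steinerC.
pose x : word q := finfun (dfwith (dfwith (fun l => 0%R : 'Z_(q l)) a) b).
have xj : x j = b by rewrite ffunE dfwith_in.
have xi : x i = a by rewrite ffunE dfwith_out // dfwith_in.
have xl l : l != i -> l != j -> x l = 0%R.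
  by move=> li lj; rewrite ffunE !dfwith_out // eq_sym.
have split_card (P : pred 'I_N) :
    #|[set l | P l]| = P i + (P j + #|[set l | [&& l != i, l != j & P l]]|).
  rewrite (cardsD1 i) (cardsD1 j) !inE ji; congr (_ + (_ + _)).
  by apply: eq_card => l; rewrite !inE; case: (l == i); case: (l == j).
have wx : weight x = 2.
  rewrite /weight split_card xi xj a0 b0 (_ : [set l | _] = set0) ?cards0 //.
  apply/setP => l; rewrite !inE.
  by apply/negP => /and3P[li lj]; rewrite (xl l li lj) eqxx.
(* Off [i] and [j], [x] vanishes, so those coordinates contribute the same number to the weight [k]
   and to the distance. Distance [k - 2] thus means that the nonzero letters of [c] at [i], [j]
   outnumber its mismatches there by 2: no mismatch, two nonzero letters. *)
have hdistE c : c \in C -> (hdist x c == k - 2) = (c i == a) && (c j == b).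
  move=> /wC; rewrite /weight /hdist (split_card (fun l => c l != 0%R)).
  rewrite (split_card (fun l => x l != c l)) xi xj.
  rewrite (_ : [set l | [&& l != i, l != j & x l != c l]]
             = [set l | [&& l != i, l != j & c l != 0%R]]); last first.
    apply/setP => l; rewrite !inE; case: (eqVneq l i) => //= li.
    by case: (eqVneq l j) => //= lj; rewrite (xl l li lj) eq_sym.
  have ci0 : c i == a -> c i != 0%R by move=> /eqP ->.
  have cj0 : c j == b -> c j != 0%R by move=> /eqP ->.
  rewrite (eq_sym a) (eq_sym b).
  move: ci0 cj0 #|_|; case: (c i == a); case: (c j == b);
    case: (c i != 0%R); case: (c j != 0%R) => ci0 cj0 m /=;
    rewrite ?(ci0 isT) ?(cj0 isT); lia.
have [c [[cC /eqP cx] c_uniq]] := uniqC x wx.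
apply/eqP/cards1P; exists c; apply/setP => c'; rewrite !inE -andbA.
apply/andP/eqP => [[c'C]|->]; last by rewrite -hdistE.
by rewrite -hdistE // => /eqP c'x; apply/esym/c_uniq.
Qed.

Lemma card_codewords_letter_coord (i j : 'I_N) (a : 'Z_(q i)) :
  j != i -> a != 0%R ->
  #|[set c in [set c in C | c i == a] | c j != 0%R]| = q j - 1.
Proof.
move=> ji a0; rewrite -sum_letters_card.
under eq_bigr => b b0 do rewrite card_codewords_with_two_letters //.
by rewrite sum1_card card_nonzero_Zp.
Qed.

Lemma card_codewords_letter (i : 'I_N) (a : 'Z_(q i)) :
  a != 0%R ->
  #|[set c in C | c i == a]| * (k - 1) = \sum_(j | j != i) (q j - 1).
Proof.
move=> a0; have [wC _ _] := steinerC.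
under eq_bigr => j ji do rewrite -(card_codewords_letter_coord ji a0).
rewrite sum_coords_weight -sum_nat_const.
apply: eq_bigr => c; rewrite inE => /andP[cC /eqP ci].
(* Besides [i], where its letter is [a], a codeword has [k - 1] nonzero coordinates. *)
rewrite -(wC _ cC) /weight (cardsD1 i) inE ci a0 addKn.
by apply: eq_card => j; rewrite !inE.
Qed.

Lemma card_steiner :
  #|C| * (k * (k - 1)) = \sum_i (q i - 1) * \sum_(j | j != i) (q j - 1).
Proof.
have [wC _ _] := steinerC.
rewrite mulnA -sum_nat_const.
rewrite (eq_bigr (fun c : word q => #|[set j | true & c j != 0%R]|)); last first.
  by move=> c cC; rewrite -(wC _ cC).
rewrite -sum_coords_weight big_distrl /=; apply: eq_bigr => i _.
rewrite -sum_letters_card big_distrl /=.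
under eq_bigr => a a0 do rewrite card_codewords_letter //.
by rewrite sum_nat_const card_nonzero_Zp.
Qed.

End PairwiseBalance.

Section BinaryAnd.

Variables n q : nat.

Lemma binary_and_max : @binary_and n q ord_max = q.
Proof. by rewrite /binary_and ltnn. Qed.

Lemma binary_and_lt (i : 'I_n.+1) : i != ord_max -> binary_and q i = 2.
Proof. by rewrite /binary_and -val_eqE /= => ni; have := ltn_ord i; case: ifP; lia. Qed.

Lemma sum_binary_and_neq_max :
  \sum_(j : 'I_n.+1 | j != ord_max) (binary_and q j - 1) = n.
Proof.
under eq_bigr => j jn do rewrite binary_and_lt //.
by rewrite sum1_card cardC1 card_ord.
Qed.

Lemma sum_binary_and_neq (i : 'I_n.+1) :
  i != ord_max ->
  \sum_(j : 'I_n.+1 | j != i) (binary_and q j - 1) = (n - 1) + (q - 1).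
Proof.
move=> ni; have := sum_binary_and_neq_max.
rewrite (bigD1 i) //= binary_and_lt // => Hn.
rewrite (bigD1 ord_max) 1?eq_sym //= binary_and_max addnC -[in n - 1]Hn addKn.
by congr (_ + _); apply: eq_bigl => j; apply: andbC.
Qed.

End BinaryAnd.

Theorem theorem6 (n q k : nat) (n_ge1 : 1 <= n) (q_ge2 : 2 <= q)
    (k_ge2 : 2 <= k) (k_leN : k <= n.+1) :
  (exists C : {set word (@binary_and n q)}, mixed_steiner 2 k C) ->
  [/\ (k - 2) * (q - 1) + 1 <= n,
      k - 1 %| n,
      q = 2 %[mod k - 1]
    & k * (k - 1) %| n * (n + 2 * q - 3)].
Proof.
move=> [C steinerC].
have Q_ge2 i : 1 < @binary_and n q i by rewrite /binary_and; case: ifP.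
(* As [n >= 1], [ord0] can serve as the binary coordinate. *)
have ord0_neq_max : ord0 != ord_max :> 'I_n.+1 by rewrite -val_eqE /=; lia.
have last1 : (1 : 'Z_(@binary_and n q ord_max))%R != 0%R by rewrite GRing.oner_eq0.
have first1 : (1 : 'Z_(@binary_and n q ord0))%R != 0%R by rewrite GRing.oner_eq0.
have dvd_n : k - 1 %| n.
  have := card_codewords_letter k_ge2 Q_ge2 steinerC last1.
  by rewrite sum_binary_and_neq_max => <-; apply: dvdn_mull.
have degree0 := card_codewords_letter k_ge2 Q_ge2 steinerC first1.
rewrite sum_binary_and_neq // in degree0.
split=> //.
(* Exactly [q - 1] codewords have letter 1 at [ord0] and a nonzero last letter, so r >= q - 1 and (q
   - 1)(k - 1) <= (n - 1) + (q - 1); cancelling q - 1 leaves the bound. *)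
- have max_neq : ord_max != ord0 :> 'I_n.+1 by rewrite eq_sym.
  have := card_codewords_letter_coord k_ge2 Q_ge2 steinerC max_neq first1.
  rewrite [X in _ = X - 1 -> _]binary_and_max => degree_last.
  have : q - 1 <= #|[set c in C | c ord0 == 1%R]|.
    rewrite -degree_last; apply/subset_leq_card/subsetP => c.
    by rewrite inE => /andP[].
  move=> /leq_mul/(_ (leqnn (k - 1))); rewrite degree0 => degree_bound.
  have : (q - 1) * (k - 1) = (k - 2) * (q - 1) + (q - 1).
    by rewrite addnC -mulSn mulnC; congr (_ * _); lia.
  lia.
(* [k - 1] divides both n and n + (q - 2) = (n - 1) + (q - 1). *)
- have q_sub2 : k - 1 %| q - 2.
    rewrite -(dvdn_addr _ dvd_n) (_ : n + _ = n - 1 + (q - 1)); last by lia.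
    by rewrite -degree0; apply: dvdn_mull.
  by apply/eqP; rewrite eqn_mod_dvd.
(* The last coordinate contributes (q - 1) n and each of the n binary ones (n - 1) + (q - 1). *)
- rewrite (_ : n * _ = #|C| * (k * (k - 1))); first exact: dvdn_mull.
  rewrite (card_steiner k_ge2 Q_ge2 steinerC) (bigD1 ord_max) //=.
  rewrite binary_and_max sum_binary_and_neq_max.
  under eq_bigr => i ni do rewrite binary_and_lt // sum_binary_and_neq //.
  rewrite sum_nat_const cardC1 card_ord; nia.
Qed.
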